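(* Let $\mathcal L$ be a finite distributive lattice, $\mathcal I$ a poset ideal and $\mathcal J$ a poset coideal of $\mathcal L$. If $\mathcal I\cup\mathcal J=\mathcal L$ and $\mathcal I\cap\mathcal J=\emptyset$, then the ideal $H_{\mathcal I}\cap H_{\mathcal J}$ has a linear resolution.
   Context: Let $P$ be the set of join-irreducible elements of $\mathcal L$ (elements with exactly one lower neighbor), with the induced order; for $p\in\mathcal L$ put $\ell(p)=\{q\in P:q\le p\}$. Let $K$ be a field and $S=K[x_p,y_p: p\in P]$ with all variables of degree 1. For $q\in\mathcal L$ put $u_q=\prod_{p\in\ell(q)}x_p\prod_{p\in P\setminus\ell(q)}y_p$, and for $\mathcal S\subseteq\mathcal L$ let $H_{\mathcal S}$ be the ideal generated by $\{u_q:q\in\mathcal S\}$. Poset ideals are closed downward, poset coideals upward. A graded ideal has a linear resolution if all its minimal generators have the same degree $d$ and in its graded minimal free resolution the $i$-th module is generated in degree $d+i$ for all $i$. *)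

(* Defs.v *)
From HB Require Import structures.
From mathcomp Require Import all_boot all_order all_algebra.
From mathcomp Require Import mpoly.
Set Implicit Arguments. Unset Strict Implicit. Unset Printing Implicit Defensive.
Import Order.TTheory GRing.Theory.
Local Open Scope order_scope.

Definition lower_cover disp (L : finDistrLatticeType disp) (q p : L) : bool :=
  (q < p) && [forall r : L, ~~ ((q < r) && (r < p))].

Definition join_irr disp (L : finDistrLatticeType disp) : {set L} :=
  [set p : L | #|[set q : L | lower_cover q p]| == 1%N].

Definition poset_ideal disp (L : finDistrLatticeType disp) (I : {set L}) : Prop :=
  forall p q : L, q <= p -> p \in I -> q \in I.

Definition poset_coideal disp (L : finDistrLatticeType disp) (J : {set L}) : Prop :=
  forall p q : L, p <= q -> p \in J -> q \in J.

Local Open Scope ring_scope.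

(* number of variables of S = K[x_p, y_p : p in P]: x_p is variable
   lshift i, y_p is variable rshift i, where p = enum_val i *)
Definition nvars disp (L : finDistrLatticeType disp) : nat :=
  (#|join_irr L| + #|join_irr L|)%N.

Definition xvar disp (L : finDistrLatticeType disp) (K : fieldType)
  (i : 'I_#|join_irr L|) : {mpoly K[nvars L]} :=
  'X_(lshift #|join_irr L| i).

Definition yvar disp (L : finDistrLatticeType disp) (K : fieldType)
  (i : 'I_#|join_irr L|) : {mpoly K[nvars L]} :=
  'X_(rshift #|join_irr L| i).

Definition u_mon disp (L : finDistrLatticeType disp) (K : fieldType) (q : L)
  : {mpoly K[nvars L]} :=
  \prod_(i : 'I_#|join_irr L|)
     (if (enum_val i <= q)%O then xvar K i else yvar K i).

Definition H_ideal disp (L : finDistrLatticeType disp) (K : fieldType)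
  (S : {set L}) (f : {mpoly K[nvars L]}) : Prop :=
  exists c : L -> {mpoly K[nvars L]}, f = \sum_(q in S) c q * u_mon K q.

(* A (graded) ideal I of R = K[X_1..X_n] (given as a membership predicate)
   has a d-linear resolution: there is a graded free resolution
     ... -> F_2 -> F_1 -> F_0 -> I -> 0,  F_i = R(-d-i)^(b i),
   i.e. the augmentation F_0 -> I sends the basis to homogeneous elements of
   degree d and all differentials are given by matrices of linear forms
   (maps of degree 0).  Free modules are row vectors, maps act on the right. *)
Definition has_linear_resolution (K : fieldType) (n : nat)
  (I : {mpoly K[n]} -> Prop) : Prop :=
  exists (d : nat) (b : nat -> nat)
         (G : 'M[{mpoly K[n]}]_(b 0%N, 1))
         (D : forall i : nat, 'M[{mpoly K[n]}]_(b i.+1, b i)),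
    [/\ (forall j, G j 0 \is d.-homog),
        (forall i j k, D i j k \is 1%N.-homog),
        (forall f, I f <-> exists v : 'rV[{mpoly K[n]}]_(b 0%N), f = (v *m G) 0 0),
        (forall v : 'rV[{mpoly K[n]}]_(b 0%N),
            v *m G = 0 <-> exists w : 'rV_(b 1%N), v = w *m D 0%N) &
        (forall (i : nat) (v : 'rV[{mpoly K[n]}]_(b i.+1)),
            v *m D i = 0 <-> exists w : 'rV_(b i.+2), v = w *m D i.+1)].

Arguments H_ideal {disp L} K S f.
Arguments has_linear_resolution {K n} I.

(* Main.v *)
(* Write [H_T] for the ideal of the [u_q], [q] in [T].  Adding the elements of a
   poset ideal in increasing order, or those of a coideal in decreasing order,
   the successive colon ideals [H_T : u_q] are generated by variables (one for
   each lower, resp. upper, neighbour of [q]), so iterated mapping cones yield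
   linear resolutions of [H_I], [H_J] and [H_L = H_I + H_J], all generated in
   degree [d = #|P|].

   Now lift [H_I (+) H_J -> H_L], [(g, h) |-> g + h], to the linear resolutions.
   For degree reasons the comparison maps are matrices of constants.  They are
   injective: in homological degree 0 because [H_I /\ H_J] has no nonzero
   element of degree [d], and then inductively because linear resolutions are
   minimal.  The quotient of the resolution of [H_L] by the image of the one of
   [H_I (+) H_J] is therefore a complex of free modules; it vanishes in degree 0
   and, shifted by one, is a linear resolution of the kernel [H_I /\ H_J]. *)
Require Import Defs.
From HB Require Import structures.
From mathcomp Require Import all_boot all_order all_algebra.
From mathcomp Require Import mpoly.
Set Implicit Arguments. Unset Strict Implicit. Unset Printing Implicit Defensive.
Import Order.TTheory GRing.Theory.
Local Open Scope ring_scope.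

(** * Choice of sequences and of matrices *)

(** Carrying the invariant [P] along with the element keeps every stage extendable; as [R] is
    boolean on a [choiceType], [xchoose] picks the successor. *)
Lemma dependent_choice_nat (T : nat -> choiceType) (P : forall i, T i -> Prop)
    (R : forall i, T i -> T i.+1 -> bool) (x0 : T 0%N) :
  P 0%N x0 -> (forall i x, P i x -> exists y, R i x y) ->
  (forall i x y, P i x -> R i x y -> P i.+1 y) ->
  exists2 s : forall i, T i, s 0%N = x0 & forall i, R i (s i) (s i.+1).
Proof.
move=> P0 Rex RP.
pose step i (x : {x : T i | P i x}) : {y : T i.+1 | P i.+1 y} :=
  exist _ (xchoose (Rex i _ (svalP x))) (RP _ _ _ (svalP x) (xchooseP _)).
pose s := nat_rect (fun i => {x : T i | P i x}) (exist _ x0 P0) step.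
exists (fun i => sval (s i)) => // i.
exact: (xchooseP (Rex i _ (svalP (s i)))).
Qed.

Lemma exists_matrix_rows (R : choiceType) (a b : nat) (P : 'I_a -> 'rV[R]_b -> bool) :
  (forall i, exists w, P i w) -> exists W : 'M[R]_(a, b), forall i, P i (row i W).
Proof.
move=> Pex; exists (\matrix_(i, j) xchoose (Pex i) 0 j) => i.
suff -> : row i (\matrix_(i, j) xchoose (Pex i) 0 j) = xchoose (Pex i) by exact: xchooseP.
by apply/rowP => j; rewrite !mxE.
Qed.

(** * Homogeneous polynomials and matrices *)

Section Homogeneous.
Variables (K : fieldType) (n : nat).
Local Notation S := {mpoly K[n]}.

(** Both sides are linear in [p], and a monomial times [q] is homogeneous of degree raised by
    [e]. *)
Lemma pihomogMr (k e : nat) (p q : S) : q \is e.-homog ->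
  pihomog mdeg (k + e) (p * q) = pihomog mdeg k p * q.
Proof.
move=> qe; elim/mpolyind: p => [|c m p _ _ IH]; first by rewrite !(mul0r, pihomog0).
rewrite mulrDl !pihomogD mulrDl IH; congr (_ + _).
rewrite -scalerAl !linearZ /= -scalerAl; congr (_ *: _).
have Xq : 'X_[m] * q \is (mdeg m + e).-homog by apply: dhomogM; rewrite ?dhomogX.
rewrite pihomogX; case: eqP => [<-|/eqP ne]; first by rewrite pihomog_dE.
by rewrite mul0r (pihomog_ne0 _ Xq) // eqn_add2r.
Qed.

Lemma dhomog0C (p : S) : p \is 0.-homog -> p = (p@_0)%:MP.
Proof.
move=> p0; apply/mpolyP => m; rewrite mcoeffC.
case: (m =P 0%MM) => [->|/eqP m0]; rewrite ?eqxx ?mulr1 //.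
rewrite ?(negbTE m0) mulr0; apply: dhomog_nemf_coeff p0 _.
by rewrite mdeg_eq0.
Qed.

Definition homogmx d a b (M : 'M[S]_(a, b)) : bool :=
  [forall i, [forall j, M i j \is d.-homog]].

Lemma homogmxP d a b (M : 'M[S]_(a, b)) :
  reflect (forall i j, M i j \is d.-homog) (homogmx d M).
Proof.
by apply: (iffP forallP) => H i; [move=> j; exact: (forallP (H i)) | apply/forallP].
Qed.

Lemma homogmxM d e a b c (M : 'M[S]_(a, b)) (N : 'M[S]_(b, c)) :
  homogmx d M -> homogmx e N -> homogmx (d + e) (M *m N).
Proof.
move=> /homogmxP Md /homogmxP Ne; apply/homogmxP => i j; rewrite mxE.
by apply: rpred_sum => k _; apply: dhomogM.
Qed.

Lemma homogmxN d a b (M : 'M[S]_(a, b)) : homogmx d M -> homogmx d (- M).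
Proof. by move=> /homogmxP Md; apply/homogmxP => i j; rewrite mxE rpredN. Qed.

Lemma homogmx0 d a b : homogmx d (0 : 'M[S]_(a, b)).
Proof. by apply/homogmxP => i j; rewrite mxE rpred0. Qed.

Lemma homogmx_col d a b c (M : 'M[S]_(a, b)) (N : 'M[S]_(c, b)) :
  homogmx d M -> homogmx d N -> homogmx d (col_mx M N).
Proof.
move=> /homogmxP Md /homogmxP Nd; apply/homogmxP => i j.
by rewrite mxE; case: splitP.
Qed.

Lemma homogmx_row d a b c (M : 'M[S]_(a, b)) (N : 'M[S]_(a, c)) :
  homogmx d M -> homogmx d N -> homogmx d (row_mx M N).
Proof.
move=> /homogmxP Md /homogmxP Nd; apply/homogmxP => i j.
by rewrite mxE; case: splitP.
Qed.

Lemma homogmx_block d a b a' b' (M : 'M[S]_(a, b)) (N : 'M[S]_(a, b'))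
    (P : 'M[S]_(a', b)) (Q : 'M[S]_(a', b')) :
  homogmx d M -> homogmx d N -> homogmx d P -> homogmx d Q ->
  homogmx d (block_mx M N P Q).
Proof. by move=> *; apply: homogmx_col; apply: homogmx_row. Qed.

Definition constmx a b (M : 'M[K]_(a, b)) : 'M[S]_(a, b) := map_mx (@mpolyC n K) M.

Lemma constmxM a b c (M : 'M[K]_(a, b)) (N : 'M[K]_(b, c)) :
  constmx (M *m N) = constmx M *m constmx N.
Proof. exact: map_mxM. Qed.

Lemma constmxD a b (M N : 'M[K]_(a, b)) : constmx (M + N) = constmx M + constmx N.
Proof. exact: map_mxD. Qed.

Lemma constmxB a b (M N : 'M[K]_(a, b)) : constmx (M - N) = constmx M - constmx N.
Proof. exact: map_mxB. Qed.

Lemma constmx1 a : constmx (1%:M : 'M[K]_a) = 1%:M.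
Proof. exact: map_mx1. Qed.

Lemma constmx0 a b : constmx (0 : 'M[K]_(a, b)) = 0.
Proof. exact: map_mx0. Qed.

Lemma homogmx_const a b (M : 'M[K]_(a, b)) : homogmx 0 (constmx M).
Proof.
apply/homogmxP => i j; rewrite mxE -alg_mpolyC; apply: rpredZ; exact: dhomog1.
Qed.

Lemma homogmx0_const a b (M : 'M[S]_(a, b)) :
  homogmx 0 M -> M = constmx (map_mx (mcoeff 0%MM) M).
Proof.
by move=> /homogmxP M0; apply/matrixP => i j; rewrite !mxE; apply: dhomog0C.
Qed.

(** Replacing each entry of an arbitrary factor by its component of degree [k] does not change the
    product, because [D] and [M] are homogeneous. This makes every lift graded. *)
Lemma homog_factor (k e : nat) a b c (M : 'M[S]_(a, b)) (D : 'M[S]_(c, b)) :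
  homogmx (k + e) M -> homogmx e D ->
  (forall i, exists w : 'rV_c, row i M = w *m D) ->
  exists2 N : 'M[S]_(a, c), homogmx k N & M = N *m D.
Proof.
move=> /homogmxP Mh /homogmxP Dh Mex.
have [i|W HW] := @exists_matrix_rows S a c (fun i w => row i M == w *m D).
  by have [w /eqP] := Mex i; exists w.
have {}HW : M = W *m D.
  by apply/row_matrixP => i; rewrite row_mul; apply/eqP.
exists (map_mx (pihomog mdeg k) W).
  by apply/homogmxP => i j; rewrite mxE pihomogP.
apply/matrixP => i j; rewrite -[LHS](pihomog_dE (Mh i j)) {1}HW !mxE raddf_sum.
by apply: eq_bigr => l _; rewrite mxE /= pihomogMr.
Qed.

End Homogeneous.

(** * Mapping cones *)

(* A chain is a family [D i : 'M_(b i, aug k b i)]: [D 0] is the augmentation to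
   the free module of rank [k], and [D i.+1 : 'M_(b i.+1, b i)]. *)
Definition aug (k : nat) (b : nat -> nat) (i : nat) : nat :=
  if i is j.+1 then b j else k.

Definition lindeg (d i : nat) : nat := if i is _.+1 then 1%N else d.

Section Resolutions.
Variables (K : fieldType) (n : nat).
Local Notation S := {mpoly K[n]}.

(** Exactness is asked at each [b i] but not at the free module of rank [k]: the image of [D 0]
    there is the module being resolved. *)
Definition exact_chain k b (D : forall i, 'M[S]_(b i, aug k b i)) : Prop :=
  forall i (v : 'rV[S]_(b i)),
    v *m D i = 0 <-> exists w : 'rV[S]_(b i.+1), v = w *m D i.+1.

Definition linres_chain d k b (D : forall i, 'M[S]_(b i, aug k b i)) : Prop :=
  (forall i, homogmx (lindeg d i) (D i)) /\ exact_chain D.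

Definition linres d (I : S -> Prop) : Prop :=
  exists b (D : forall i, 'M[S]_(b i, aug 1 b i)),
    linres_chain d D /\
    forall f, I f <-> exists v : 'rV[S]_(b 0%N), f%:M = v *m D 0%N.

Lemma linres_has_linear_resolution d (I : S -> Prop) :
  linres d I -> has_linear_resolution I.
Proof.
case=> b [D [[Dh Dx] DI]].
exists d, b, (D 0%N), (fun i => D i.+1); split.
- by move=> j; apply: (homogmxP _ _ (Dh 0%N)).
- by move=> i j k; apply: (homogmxP _ _ (Dh i.+1)).
- move=> f; rewrite DI; split=> -[v Hv]; exists v.
    by rewrite -Hv mxE.
  by apply/matrixP => i j; rewrite !ord1 -Hv mxE.
- exact: (Dx 0%N).
- by move=> i; apply: (Dx i.+1).
Qed.

Lemma linres_ext d (I J : S -> Prop) :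
  (forall f, I f <-> J f) -> linres d I -> linres d J.
Proof.
move=> IJ [b [D [Dl DI]]]; exists b, D; split=> // f.
by rewrite -IJ.
Qed.

Lemma exact_chain_comp k b (D : forall i, 'M[S]_(b i, aug k b i)) i :
  exact_chain D -> D i.+1 *m D i = 0.
Proof.
move=> Dx; apply/row_matrixP => r; rewrite row_mul row0; apply/Dx.
by exists (delta_mx 0 r); rewrite -rowE.
Qed.

(** A constant row in the kernel of [D i] lies in the image of [D i.+1], whose entries are linear
    forms, so its constant term vanishes. *)
Lemma linres_chain_minimal d k b (D : forall i, 'M[S]_(b i, aug k b i))
    a i (M : 'M[K]_(a, b i)) :
  linres_chain d D -> constmx n M *m D i = 0 -> M = 0.
Proof.
move=> [Dh Dx] MD; apply/matrixP => r j.
have /Dx[w Hw] : row r (constmx n M) *m D i = 0 by rewrite -row_mul MD row0.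
move/matrixP: Hw => /(_ 0 j)/(congr1 (mcoeff 0%MM)).
rewrite !mxE mcoeffC eqxx mulr1 => ->; rewrite raddf_sum big1 // => l _.
rewrite /= rmorphM /= [X in _ * X](_ : _ = 0) ?mulr0 //.
by apply: dhomog_nemf_coeff (homogmxP _ _ (Dh i.+1) l j) _; rewrite /= mdeg0.
Qed.

(** The graded comparison theorem. Indices follow [aug]: [phi 0] acts on the targets of the
    augmentations, and [phi i] has degree [g i]. *)
Lemma lift_chain_map k b (D : forall i, 'M[S]_(b i, aug k b i))
    k' c (E : forall i, 'M[S]_(c i, aug k' c i)) (dD dE g : nat -> nat)
    (phi0 : 'M[S]_(k', k)) :
  exact_chain D -> exact_chain E ->
  (forall i, homogmx (dD i) (D i)) -> (forall i, homogmx (dE i) (E i)) ->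
  (forall i, g i.+1 + dD i = dE i + g i)%N -> homogmx (g 0%N) phi0 ->
  (forall r, exists w, row r (E 0%N *m phi0) = w *m D 0%N) ->
  exists2 phi : forall i, 'M[S]_(aug k' c i, aug k b i),
    phi 0%N = phi0 &
    forall i, homogmx (g i.+1) (phi i.+1) /\ phi i.+1 *m D i = E i *m phi i.
Proof.
move=> Dx Ex Dh Eh dg phi0h phi0i.
pose T i : choiceType := 'M[S]_(aug k' c i, aug k b i).
pose P i (x : T i) :=
  homogmx (g i) x /\ forall r, exists w, row r (E i *m x) = w *m D i.
pose R i (x : T i) (y : T i.+1) :=
  homogmx (g i.+1) (y : 'M_(_, _)) && ((y : 'M_(_, _)) *m D i == E i *m x).
have [||i x y [xh _] /andP[yh /eqP Hy]|phi phiE phiR] :=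
  @dependent_choice_nat T P R phi0.
- by [].
- move=> i x [xh xi].
  have [] := @homog_factor _ _ (g i.+1) (dD i) _ _ _ (E i *m x) (D i) => //.
    by rewrite dg; apply: homogmxM.
  by move=> N Nh NE; exists N; rewrite /R Nh NE eqxx.
- split=> // r; apply/Dx.
  by rewrite -row_mul -mulmxA Hy mulmxA exact_chain_comp // mul0mx row0.
by exists phi => // i; have /andP[? /eqP] := phiR i.
Qed.

Lemma linres0 d : linres d (fun f => f = 0).
Proof.
exists (fun=> 0%N), (fun=> 0); split.
  split=> [i|i v]; first exact: homogmx0.
  by rewrite mulmx0; split=> // _; exists 0; rewrite thinmx0 mulmx0.
move=> f; split=> [->|[v]]; first by exists 0; rewrite mulmx0 raddf0.
by rewrite mulmx0 => /matrixP/(_ 0 0); rewrite !mxE.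
Qed.

(** Here [V] is the colon ideal [I : m]. Multiplication by [m] maps [S/V] injectively to [S/I] with
    cokernel [S/(I + (m))], which the mapping cone of a lift resolves. *)
Lemma linres_cone d (I V : S -> Prop) (m : S) :
  linres d I -> linres 1 V -> m \is d.-homog ->
  (forall f, V f <-> I (f * m)) ->
  linres d (fun f => exists g, I (f - g * m)).
Proof.
move=> [b [D [[Dh Dx] DI]]] [c [E [[Eh Ex] EV]]] md VI.
have Dc i : D i.+1 *m D i = 0 by apply: exact_chain_comp.
have Ec i : E i.+1 *m E i = 0 by apply: exact_chain_comp.
(* Since [V] is generated by linear forms, all of [E] is linear; starting from [m] of degree [d],
   all later lifts are then linear. *)
have [|||r|phi phi0 phiE] :=
  @lift_chain_map _ _ D _ _ E (lindeg d) (fun=> 1%N) (lindeg d) m%:M Dx Ex Dh.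
- by move=> i; have := Eh i; case: i.
- by case.
- by apply/homogmxP => i j; rewrite !ord1 mxE eqxx.
- rewrite row_mul; have : V (row r (E 0%N) 0 0).
    apply/EV; exists (delta_mx 0 r); rewrite -rowE.
    by apply/matrixP => i j; rewrite !ord1 !mxE eqxx.
  move/VI/DI => [v Hv]; exists v; rewrite -Hv.
  by apply/matrixP => i j; rewrite !ord1 !mxE big_ord1 !mxE.
have phiC i : phi i.+1 *m D i = E i *m phi i by case: (phiE i).
(* The resolution of [V] enters shifted by one place; at place 0 its share [aug 1 c 0 = 1] is the
   new generator [m]. *)
exists (fun i => b i + aug 1 c i)%N.
exists (fun i => match i return 'M[S]_(b i + aug 1 c i,
                   aug 1 (fun i => b i + aug 1 c i)%N i) with
  | 0%N => col_mx (D 0%N) (phi 0%N)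
  | j.+1 => block_mx (D j.+1) 0 (phi j.+1) (- E j)
  end).
split; first split.
- case=> [|i]; last first.
    apply: homogmx_block.
    + exact: (Dh i.+1).
    + exact: homogmx0.
    + by case: (phiE i).
    + by have := Eh i; case: (i) => [|j] Hh; apply: homogmxN.
  apply: homogmx_col; first exact: (Dh 0%N).
  by rewrite phi0; apply/homogmxP => i j; rewrite !ord1 mxE eqxx.
(* Both halves of exactness are stated uniformly, with [v2] in the image of [E i]; at place 0 this
   comes from the colon condition, later from exactness of [E]. *)
- have zero_of_im i (w : 'rV[S]_(b i.+1 + c i)) :
      exists v1 v2, [/\ w *m block_mx (D i.+1) 0 (phi i.+1) (- E i) = row_mx v1 v2,
        v1 *m D i + v2 *m phi i = 0 & exists w2, v2 = w2 *m E i].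
    rewrite -[w]hsubmxK mul_row_block mulmx0 add0r.
    exists (lsubmx w *m D i.+1 + rsubmx w *m phi i.+1), (rsubmx w *m - E i); split=> //.
      by rewrite mulmxDl -!mulmxA Dc mulmx0 phiC mulNmx mulmxN add0r subrr.
    by exists (- rsubmx w); rewrite mulmxN mulNmx.
  have im_of_zero i v1 v2 : v1 *m D i + v2 *m phi i = 0 ->
      (exists w2, v2 = w2 *m E i) ->
      exists w : 'rV[S]_(b i.+1 + c i),
        row_mx v1 v2 = w *m block_mx (D i.+1) 0 (phi i.+1) (- E i).
    move=> v12 [w2 Hw2].
    have /Dx[w1 Hw1] : (v1 + w2 *m phi i.+1) *m D i = 0.
      by rewrite mulmxDl -mulmxA phiC mulmxA -Hw2.
    exists (row_mx w1 (- w2)).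
    by rewrite mul_row_block mulmx0 add0r -Hw1 mulNmx addrK mulmxN mulNmx opprK Hw2.
  case=> [|i] v; split.
  + rewrite -[v]hsubmxK mul_row_col => v12; apply: im_of_zero => //.
    have /EV[w Hw] : V (rsubmx v 0 0).
      apply/VI/DI; exists (- lsubmx v); rewrite mulNmx; apply/eqP.
      rewrite -addr_eq0 -[X in _ == X]v12 addrC phi0; apply/eqP; congr (_ + _).
      by apply/matrixP => i j; rewrite !ord1 !mxE big_ord1 !mxE.
    by exists w; rewrite -Hw; apply/matrixP => i j; rewrite !ord1 [RHS]mxE.
  + by case=> w ->; have [v1 [v2 [-> v12 _]]] := zero_of_im _ w; rewrite mul_row_col.
  + rewrite -[v]hsubmxK mul_row_block mulmx0 add0r -row_mx0.
    case/eq_row_mx => v12 /eqP; rewrite mulmxN oppr_eq0 => /eqP/Ex v2E.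
    exact: im_of_zero.
  + case=> w ->; have [v1 [v2 [-> v12 [w2 v2E]]]] := zero_of_im _ w.
    by rewrite mul_row_block v12 v2E mulmxN -mulmxA Ec !mulmx0 add0r oppr0 row_mx0.
- move=> f; split=> [[g /DI[v Hv]]|[v Hv]].
    exists (row_mx v g%:M); rewrite mul_row_col -Hv phi0 -scalar_mxM -raddfD /=.
    by rewrite subrK.
  exists (rsubmx v 0 0); apply/DI; exists (lsubmx v).
  rewrite raddfB /= Hv -[v in v *m _]hsubmxK mul_row_col phi0.
  apply/eqP; rewrite subr_eq; apply/eqP; congr (_ + _).
  by apply/matrixP => i j; rewrite !ord1 !mxE big_ord1 !mxE.
Qed.
End Resolutions.

(** * Resolving an intersection *)

(** The rows of [f] and a basis [s] of a complement form an invertible matrix with inverse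
    [row_mx h p]; the identities are blocks of the two inverse laws. *)
Lemma row_free_complement (K : fieldType) a c (f : 'M[K]_(a, c)) :
  let s := row_base f^C%MS in
  let h := lsubmx (pinvmx (col_mx f s)) in
  let p := rsubmx (pinvmx (col_mx f s)) in
  row_free f ->
  [/\ f *m h = 1%:M, f *m p = 0, s *m p = 1%:M & h *m f + p *m s = 1%:M].
Proof.
move=> s h p ffree; set M := col_mx f s in h p *.
have Mrank : \rank M = c.
  rewrite -(addsmxE f s) (adds_eqmx (eqmx_refl f) (eq_row_base _)).
  exact/eqP/addsmx_compl_full.
have Mfree : row_free M.
  rewrite -row_leq_rank Mrank mxrank_compl (eqP ffree) subnKC //.
  by rewrite -(eqP ffree) rank_leq_col.
have := mulmxVp Mfree; rewrite -[pinvmx M]hsubmxK mul_col_row scalar_mx_block.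
case/eq_block_mx => ? ? _ ?; split=> //.
by rewrite -mul_row_col hsubmxK mulVpmx // /row_full Mrank.
Qed.

Section Intersection.
Variables (K : fieldType) (n : nat).
Local Notation S := {mpoly K[n]}.

(** Both branches have the same body; the case split only lets [aug] reduce so that the blocks
    typecheck. *)
Definition sum_chain k1 b1 (D1 : forall i, 'M[S]_(b1 i, aug k1 b1 i))
    k2 b2 (D2 : forall i, 'M[S]_(b2 i, aug k2 b2 i)) (i : nat) :
    'M[S]_(b1 i + b2 i, aug (k1 + k2) (fun i => b1 i + b2 i)%N i) :=
  match i with
  | 0%N => block_mx (D1 0%N) 0 0 (D2 0%N)
  | j.+1 => block_mx (D1 j.+1) 0 0 (D2 j.+1)
  end.

Lemma linres_sum_chain d k1 b1 (D1 : forall i, 'M[S]_(b1 i, aug k1 b1 i))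
    k2 b2 (D2 : forall i, 'M[S]_(b2 i, aug k2 b2 i)) :
  linres_chain d D1 -> linres_chain d D2 -> linres_chain d (sum_chain D1 D2).
Proof.
move=> [h1 x1] [h2 x2]; split=> [i|i v].
  have := h1 i; have := h2 i.
  by case: i => [|i] ? ?; apply: homogmx_block => //; apply: homogmx0.
have -> : v *m sum_chain D1 D2 i = 0 <->
    lsubmx v *m D1 i = 0 /\ rsubmx v *m D2 i = 0.
  rewrite -{1}[v]hsubmxK; case: i v => [|i] v;
    rewrite mul_row_block !mulmx0 addr0 add0r -row_mx0;
    by split=> [/eq_row_mx|[-> ->]].
rewrite x1 x2; split=> [[[w1 E1] [w2 E2]]|[w ->]].
  exists (row_mx w1 w2).
  by rewrite mul_row_block !mulmx0 addr0 add0r -E1 -E2 hsubmxK.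
rewrite -[w]hsubmxK mul_row_block !mulmx0 addr0 add0r row_mxKl row_mxKr.
by split; [exists (lsubmx w)|exists (rsubmx w)].
Qed.

(** The third hypothesis resolves [A + B]; the fourth starts the induction for injectivity of the
    comparison maps. *)
Lemma linres_cap d (A B : S -> Prop) :
  linres d A -> linres d B ->
  linres d (fun f => exists g h, [/\ A g, B h & f = g + h]) ->
  (forall f, A f -> B f -> f \is d.-homog -> f = 0) ->
  linres d.+1 (fun f => A f /\ B f).
Proof.
move=> [b1 [D1 [D1l D1A]]] [b2 [D2 [D2l D2B]]] [c [E [El EAB]]] AB0.
pose b i := (b1 i + b2 i)%N.
pose D i : 'M[S]_(b i, aug (1 + 1) b i) := sum_chain D1 D2 i.
have Dl : linres_chain d D by apply: linres_sum_chain.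
have [[Dh Dx] [Eh Ex]] := (Dl, El).
pose phi0 : 'M[S]_(1 + 1, 1) := col_mx 1%:M 1%:M.
have DAB (t : 'rV_(b 0%N)) :
    exists g h, [/\ A g, B h & t *m D 0%N = row_mx g%:M h%:M].
  exists ((lsubmx t *m D1 0%N) 0 0), ((rsubmx t *m D2 0%N) 0 0); split.
  - by apply/D1A; exists (lsubmx t); rewrite -mx11_scalar.
  - by apply/D2B; exists (rsubmx t); rewrite -mx11_scalar.
  by rewrite -{1}[t]hsubmxK /D /= mul_row_block !mulmx0 addr0 add0r -!mx11_scalar.
have ABD g h : A g -> B h -> exists t, row_mx g%:M h%:M = t *m D 0%N.
  move=> /D1A[t1 t1E] /D2B[t2 t2E]; exists (row_mx t1 t2).
  by rewrite /D /= mul_row_block !mulmx0 addr0 add0r t1E t2E.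
have BN g : B g -> B (- g).
  move=> /D2B[w wE]; apply/D2B; exists (- w).
  by rewrite mulNmx -wE -raddfN.
have [||r|phi phiE phiC] :=
  @lift_chain_map _ _ _ _ E _ _ D (lindeg d) (lindeg d) (fun=> 0%N) phi0 Ex Dx Eh Dh.
- by move=> i; rewrite addn0.
- by apply: homogmx_col; rewrite -(constmx1 _ n); apply: homogmx_const.
- rewrite row_mul rowE.
  have [g [h [Ag Bh ->]]] := DAB (delta_mx 0 r).
  rewrite mul_row_col !mulmx1 -raddfD /=; apply/EAB.
  by exists g, h.
pose f i : 'M[K]_(b i, c i) := map_mx (mcoeff 0%MM) (phi i.+1).
have fE i : phi i.+1 = constmx n (f i).
  by apply/homogmx0_const; case: (phiC i).
have fC0 : constmx n (f 0%N) *m E 0%N = D 0%N *m phi0.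
  by rewrite -fE -phiE; case: (phiC 0%N).
have fC i : constmx n (f i.+1) *m E i.+1 = D i.+1 *m constmx n (f i).
  by rewrite -!fE; case: (phiC i.+1).
(* At 0, a constant [v] with [v f = 0] gives [v D = (g, -g)] with [g] of degree [d] in both ideals,
   so [g = 0]. Later, commutation and a right inverse of [f i] give [v D = 0]. Minimality concludes
   in both cases. *)
have ffree i : row_free (f i).
  elim: i => [|i IH]; apply: inj_row_free => v vf.
    suff : constmx n v *m D 0%N = 0 by apply: linres_chain_minimal.
    have [g [h [Ag Bh vD]]] := DAB (constmx n v).
    have : constmx n v *m D 0%N *m phi0 = 0.
      by rewrite -mulmxA -fC0 mulmxA -constmxM vf constmx0 mul0mx.
    rewrite vD mul_row_col !mulmx1 -raddfD /= => /matrixP/(_ 0 0).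
    rewrite !mxE eqxx mulr1n => gh.
    have Bg : B g by rewrite (_ : g = - h); [exact: BN | apply/eqP; rewrite -addr_eq0 gh].
    have g0 : g = 0.
      apply: AB0 => //; have := homogmxM (homogmx_const n v) (Dh 0%N).
      rewrite [_ *m _]vD => /homogmxP/(_ 0 (lshift 1 0)).
      by rewrite row_mxEl mxE eqxx.
    by move: gh; rewrite g0 add0r => ->; rewrite raddf0 row_mx0.
  suff : constmx n v *m D i.+1 = 0 by apply: linres_chain_minimal.
  have /(congr1 (mulmx^~ (constmx n (pinvmx (f i))))) :
      constmx n v *m D i.+1 *m constmx n (f i) = 0.
    by rewrite -mulmxA -fC mulmxA -constmxM vf constmx0 mul0mx.
  by rewrite -mulmxA -constmxM mulmxVp // constmx1 mulmx1 mul0mx.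
(* [p i] is the projection of the target onto the cokernel of [F i], [s i] a
   section of it and [h i] a retraction of [F i]. *)
pose s i := constmx n (row_base (f i)^C%MS).
pose h i := constmx n (lsubmx (pinvmx (col_mx (f i) (row_base (f i)^C%MS)))).
pose p i := constmx n (rsubmx (pinvmx (col_mx (f i) (row_base (f i)^C%MS)))).
pose F i := constmx n (f i).
have {}fC i : F i.+1 *m E i.+1 = D i.+1 *m F i by apply: fC.
have [fh fp sp hfps] : [/\ forall i, F i *m h i = 1%:M, forall i, F i *m p i = 0,
    forall i, s i *m p i = 1%:M & forall i, h i *m F i + p i *m s i = 1%:M].
  by split=> i; have [E1 E2 E3 E4] := row_free_complement (ffree i);
    rewrite -!constmxM -?constmxD ?E1 ?E2 ?E3 ?E4 ?constmx1 ?constmx0.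
have Ec i : E i.+1 *m E i = 0 by apply: exact_chain_comp.
have Dc i : D i.+1 *m D i = 0 by apply: exact_chain_comp.
have psE i : p i *m s i = 1%:M - h i *m F i by rewrite -(hfps i) addrC addKr.
(* The generators [E 0] of [A + B] come from [A (+) B] through a constant [N]; minimality forces
   [N F = 1], so [p = N F p = 0]. *)
have p0 : p 0%N = 0.
  have [||r|N Nh NE] :=
    @homog_factor _ _ 0 d _ _ _ (E 0%N) (D 0%N *m phi0).
  - exact: (Eh 0%N).
  - rewrite -[d]addn0; apply: homogmxM; first exact: (Dh 0%N).
    by apply: homogmx_col; rewrite -(constmx1 _ n); apply: homogmx_const.
  - have : exists v, (row r (E 0%N) 0 0)%:M = v *m E 0%N.
      by exists (delta_mx 0 r); rewrite -rowE -mx11_scalar.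
    move/EAB => [g [k [Ag Bk gk]]]; have [t tE] := ABD _ _ Ag Bk.
    exists t; rewrite mulmxA -tE mul_row_col !mulmx1 -raddfD /= -gk.
    by rewrite -mx11_scalar.
  have NF : N *m F 0%N = 1%:M.
    apply/eqP; rewrite -subr_eq0 (homogmx0_const Nh) -constmxM -(constmx1 _ n).
    rewrite -constmxB; apply/eqP; rewrite -[RHS]constmx0; congr constmx.
    apply: (linres_chain_minimal (i := 0%N) El).
    rewrite constmxB constmxM -(homogmx0_const Nh) constmx1 mulmxBl mul1mx.
    by rewrite -mulmxA fC0 -NE subrr.
  by rewrite -[LHS]mul1mx -NF -mulmxA fp mulmx0.
have hF0 : h 0%N *m F 0%N = 1%:M by rewrite -(hfps 0%N) p0 mul0mx addr0.
pose e i := \rank (f i)^C%MS.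
(* [s E p] is the differential induced on the cokernel, since [E] carries the image of [F] into the
   image of [F]. *)
have pd i : p i.+1 *m (s i.+1 *m E i.+1 *m p i) = E i.+1 *m p i.
  rewrite !mulmxA psE !mulmxBl mul1mx -[h _ *m F _ *m _]mulmxA fC -!mulmxA.
  by rewrite fp !mulmx0 subr0.
(* The connecting map: lift from the cokernel by [s], apply [E], and pull back along [F 0], whose
   inverse is [h 0]. The existential keeps it opaque. *)
have [del0 del0E] : exists M : 'M[S]_(e 1%N, b 0%N), M = s 1%N *m E 1%N *m h 0%N.
  by eexists.
have pd0 : p 1%N *m del0 = E 1%N *m h 0%N - h 1%N *m D 1%N.
  rewrite del0E !mulmxA psE !mulmxBl mul1mx -[h _ *m F _ *m _]mulmxA fC.
  by rewrite -!mulmxA fh mulmx1.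
have cancelF i (t : 'rV_(b i)) : t *m F i = 0 -> t = 0.
  by move=> tF; rewrite -[t]mulmx1 -(fh i) mulmxA tF mul0mx.
(* The kernel of [phi0] consists of the pairs [(g, -g)]; [pr] reads off [g]. *)
pose pr : 'M[S]_(1 + 1, 1) := col_mx 1%:M 0.
have DE0 : D 0%N *m phi0 = F 0%N *m E 0%N by [].
have del0phi0 : del0 *m D 0%N *m phi0 = 0.
  by rewrite -mulmxA DE0 del0E mulmxA -[_ *m h 0%N *m _]mulmxA hF0 mulmx1 -mulmxA Ec mulmx0.
have prE (v : 'rV_(1 + 1)) : v *m phi0 = 0 -> exists g, v = row_mx g%:M (- g)%:M /\ v *m pr = g%:M.
  rewrite -[v]hsubmxK !mul_row_col mulmx0 addr0 !mulmx1 => /eqP.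
  rewrite addrC addr_eq0 => /eqP ->; exists (lsubmx v 0 0).
  by rewrite raddfN /= -mx11_scalar.
(* The difference of two lifts with equal image under [E] is some [w E], and [w p] is the wanted
   preimage. Both exactness cases below reduce to this. *)
have im_of_eq i (v : 'rV_(e i.+1)) t :
    v *m s i.+1 *m E i.+1 = t *m F i.+1 *m E i.+1 ->
    exists w, v = w *m (s i.+2 *m E i.+2 *m p i.+1).
  move=> vt; have /Ex[w wE] : (v *m s i.+1 - t *m F i.+1) *m E i.+1 = 0.
    by rewrite mulmxBl vt subrr.
  exists (w *m p i.+2); rewrite -mulmxA pd mulmxA -wE mulmxBl -!mulmxA.
  by rewrite sp fp !mulmx0 subr0 mulmx1.
(* The cokernel vanishes at place 0, hence the shift; the augmentation has degree [d.+1], one from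
   [del0] and [d] from [D 0]. *)
exists (fun i => e i.+1).
exists (fun i => match i return 'M[S]_(e i.+1, aug 1 (fun i => e i.+1) i) with
  | 0%N => del0 *m D 0%N *m pr
  | j.+1 => s j.+2 *m E j.+2 *m p j.+1
  end).
split; first split.
- case=> [|i].
    have prh : homogmx 0 pr.
      by apply: homogmx_col; rewrite -?(constmx1 _ n) ?homogmx_const ?homogmx0.
    have delh : homogmx 1 del0.
      rewrite del0E.
      exact: homogmxM (homogmxM (homogmx_const n _) (Eh 1%N)) (homogmx_const n _).
    by have := homogmxM (homogmxM delh (Dh 0%N)) prh; rewrite addn0.
  exact: homogmxM (homogmxM (homogmx_const n _) (Eh i.+2)) (homogmx_const n _).
- case=> [|i] v; split.
  + rewrite !mulmxA => vpr.
    have [|g [gE gpr]] := prE (v *m del0 *m D 0%N).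
      by rewrite -!mulmxA [del0 *m _]mulmxA del0phi0 mulmx0.
    have g0 : g%:M = 0 :> 'M[S]_1 by rewrite -gpr vpr.
    have /Dx[t tE] : v *m del0 *m D 0%N = 0.
      by rewrite gE raddfN /= g0 oppr0 row_mx0.
    apply: (im_of_eq 0%N _ t); rewrite -[RHS]mulmxA fC mulmxA -tE del0E.
    by rewrite -!mulmxA hF0 mulmx1.
  + case=> w ->; rewrite -!mulmxA [p 1%N *m (del0 *m _)]mulmxA pd0 mulmxBl.
    rewrite -!mulmxA [D 1%N *m (D 0%N *m _)]mulmxA Dc mul0mx mulmx0 subr0.
    by rewrite [E 2%N *m (E 1%N *m _)]mulmxA Ec mul0mx !mulmx0.
  (* [x] dies in the cokernel, so it equals [x h F]; injectivity of [F] then makes [x h] a cycle of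
     [D]. *)
  + rewrite !mulmxA => vp; set x := v *m s i.+2 *m E i.+2 in vp.
    have xE : x = x *m h i.+1 *m F i.+1.
      by rewrite -[LHS]mulmx1 -(hfps i.+1) mulmxDr !mulmxA vp mul0mx addr0.
    have /Dx[t tE] : x *m h i.+1 *m D i.+1 = 0.
      apply: (cancelF i); rewrite -[_ *m F i]mulmxA -fC mulmxA -xE.
      by rewrite /x -[_ *m E i.+1]mulmxA Ec mulmx0.
    by apply: (im_of_eq i.+1 _ t); rewrite -[RHS]mulmxA fC mulmxA -tE.
  + case=> w ->; have := pd i.+1; rewrite -!mulmxA => ->.
    by rewrite [E i.+3 *m _]mulmxA Ec mul0mx !mulmx0.
- move=> f0; split=> [[Af Bf]|[v vE]].
    (* Lift [(f0, -f0)] to [t]; then [t F = w E], and [w p] maps to [t] up to a multiple of [D 1],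
       which [D 0] kills. *)
    have [t tE] := ABD _ _ Af (BN _ Bf).
    have /Ex[w wE] : t *m F 0%N *m E 0%N = 0.
      by rewrite -mulmxA -DE0 mulmxA -tE mul_row_col !mulmx1 raddfN /= subrr.
    exists (w *m p 1%N); rewrite !mulmxA -[w *m _ *m del0]mulmxA pd0 mulmxBr mulmxBl.
    rewrite !mulmxA -wE -[t *m _ *m _]mulmxA fh mulmx1 -[w *m _ *m _ *m D 0%N]mulmxA.
    by rewrite Dc mulmx0 subr0 -tE mul_row_col mulmx1 mulmx0 addr0.
  have [g [k [Ag Bk gk]]] := DAB (v *m del0).
  have [|g' [gE gpr]] := prE (v *m del0 *m D 0%N).
    by rewrite -!mulmxA [del0 *m _]mulmxA del0phi0 mulmx0.
  have scal_inj (x y : S) : x%:M = y%:M :> 'M[S]_1 -> x = y.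
    by move/matrixP/(_ 0 0); rewrite !mxE eqxx !mulr1n.
  have /scal_inj -> : f0%:M = g'%:M :> 'M[S]_1 by rewrite vE -gpr !mulmxA.
  move: gE; rewrite gk => /eq_row_mx[/scal_inj <- /scal_inj kg].
  by split=> //; rewrite -[g]opprK -kg; apply: BN.
Qed.
End Intersection.

(** * Ideals generated by variables *)

Section VariableIdeals.
Variables (K : fieldType) (n : nat).
Local Notation S := {mpoly K[n]}.

Lemma mpoly_ring_ind (P : S -> Prop) :
  (forall c, P c%:MP) -> (forall i, P 'X_i) ->
  (forall p q, P p -> P q -> P (p + q)) -> (forall p q, P p -> P q -> P (p * q)) ->
  forall p, P p.
Proof.
move=> PC PX PD PM; elim/mpolyind => [|c m p _ _ Pp]; first exact: PC 0.
apply: PD => //; rewrite -mul_mpolyC; apply: (PM _ _ (PC c)).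
rewrite mpolyXE_id; apply: big_ind => [||i _]; [exact: PC 1 | exact: PM |].
by elim: (m i) => [|k IH]; [exact: PC 1 | rewrite exprS; apply: PM].
Qed.

(* Setting the variables of [V] to 0; its kernel is the ideal generated by [V]. *)
Definition kill (V : {set 'I_n}) : S -> S :=
  mmap (@mpolyC n K) (fun i => if i \in V then 0 else 'X_i).

HB.instance Definition _ V := GRing.RMorphism.on (kill V).

Lemma killC V c : kill V c%:MP = c%:MP. Proof. exact: mmapC. Qed.

Lemma killX V i : kill V 'X_i = if i \in V then 0 else 'X_i.
Proof. by rewrite /kill mmapX mmap1U. Qed.

Lemma kill_set0 f : kill set0 f = f.
Proof.
elim/mpoly_ring_ind: f => [c|i|p q Hp Hq|p q Hp Hq].
- exact: killC.
- by rewrite killX inE.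
- by rewrite rmorphD /= Hp Hq.
- by rewrite rmorphM /= Hp Hq.
Qed.

Lemma kill_kill V W f : kill V (kill W f) = kill (V :|: W) f.
Proof.
elim/mpoly_ring_ind: f => [c|i|p q Hp Hq|p q Hp Hq].
- by rewrite !killC.
- rewrite !killX inE orbC; case: (i \in W); first by rewrite rmorph0.
  by rewrite killX.
- by rewrite !rmorphD /= Hp Hq.
- by rewrite !rmorphM /= Hp Hq.
Qed.

(** For [kill V f = 0] this puts [f] in the ideal generated by the variables of [V]. *)
Lemma sub_kill V f : exists g : 'I_n -> S, f - kill V f = \sum_(i in V) g i * 'X_i.
Proof.
elim/mpoly_ring_ind: f => [c|i|p q [g Hg] [h Hh]|p q [g Hg] [h Hh]].
- by exists (fun=> 0); rewrite killC subrr big1 // => i _; rewrite mul0r.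
- rewrite killX; case: ifP => [iV|_]; last first.
    by exists (fun=> 0); rewrite subrr big1 // => j _; rewrite mul0r.
  exists (fun j => (j == i)%:R); rewrite subr0 (bigD1 i) //= eqxx mul1r big1 ?addr0 //.
  by move=> j /andP[_ /negbTE->]; rewrite mul0r.
- exists (fun i => g i + h i); rewrite rmorphD opprD addrACA Hg Hh -big_split.
  by apply: eq_bigr => i _; rewrite mulrDl.
- exists (fun i => q * g i + kill V p * h i).
  transitivity (q * (p - kill V p) + kill V p * (q - kill V q)).
    by rewrite rmorphM !mulrBr [q * p]mulrC [q * _]mulrC addrA subrK.
  rewrite Hg Hh !mulr_sumr -big_split; apply: eq_bigr => i _ /=.
  by rewrite mulrDl !mulrA.
Qed.

Lemma kill_prodX V (I : finType) (w : I -> 'I_n) :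
  (kill V (\prod_r 'X_(w r)) == 0) = [exists r, w r \in V].
Proof.
rewrite rmorph_prod /=; apply/idP/existsP => [/prodf_eq0[r _]|[r rV]].
  rewrite killX; case: ifP => [wV _|_ /eqP X0]; first by exists r.
  by move: (congr1 (mcoeff U_(w r)) X0) => /eqP; rewrite mcoeffXU eqxx mcoeff0 oner_eq0.
by apply/prodf_eq0; exists r => //; rewrite killX rV.
Qed.

(** A variable outside [T] is a nonzerodivisor modulo the variables of [T], so the colon ideal is
    the ideal itself and cones add one variable at a time. *)
Lemma linres_kill V : linres 1 (fun f => kill V f = 0).
Proof.
rewrite -[V](set_enum V); elim: (enum V) => [|x s IH].
  apply: linres_ext (linres0 _ _ 1) => f.
  by rewrite [finset _](_ : _ = set0) ?kill_set0 //; apply/setP => i; rewrite !inE.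
have -> : [set y in x :: s] = x |: [set y in s] by apply/setP => i; rewrite !inE.
have [xs|xs] := boolP (x \in [set y in s]); first by rewrite (setUidPr _) ?sub1set.
move: {s} [set y in s] xs IH => T xT IH.
have kX g : kill T (g * 'X_x) = kill T g * 'X_x by rewrite rmorphM /= killX (negbTE xT).
have X0 : 'X_x != 0 :> S.
  apply/eqP => /(congr1 (mcoeff U_(x)))/eqP; rewrite mcoeffXU eqxx mcoeff0.
  by rewrite oner_eq0.
have := @linres_cone _ _ 1 _ _ 'X_x IH IH.
rewrite dhomogX /= mdeg1 => /(_ isT) cone.
apply: linres_ext (cone _) => f; last first.
  by rewrite kX; split=> [->|/eqP]; rewrite ?mul0r // mulf_eq0 (negbTE X0) orbF => /eqP.
rewrite -kill_kill; split=> [[g]|k0].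
  rewrite rmorphB /= kX => /eqP; rewrite subr_eq0 => /eqP ->.
  by rewrite rmorphM /= killX set11 mulr0.
have [g] := sub_kill [set x] (kill T f); rewrite k0 subr0 big_set1 => fE.
exists (g x); rewrite rmorphB /= -fE kill_kill setUid subrr //.
Qed.

End VariableIdeals.

(** * Join-irreducibles and covers *)

Section Lattice.
Variables (disp : Order.disp_t) (L : finDistrLatticeType disp).
Local Open Scope order_scope.
Implicit Types (p q r x y z : L).

Lemma card_downset_lt x y : x < y ->
  (#|[set z : L | (z <= x)%O]| < #|[set z : L | (z <= y)%O]|)%N.
Proof.
move=> xy; apply: proper_card; apply/properP; split.
  by apply/subsetP => z; rewrite !inE => /le_trans-> //; apply: ltW.
by exists y; rewrite inE ?lexx // lt_geF.
Qed.

Lemma ex_maximal (P : pred L) x : P x ->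
  exists2 y, P y & forall z, y < z -> ~~ P z.
Proof.
move=> Px; case: (@arg_maxnP _ x P (fun y => #|[set z : L | z <= y]|) Px) => y Py ymax.
exists y => // z yz; apply/negP => /ymax /=; rewrite leqNgt.
by rewrite card_downset_lt.
Qed.

Lemma ex_minimal (P : pred L) x : P x ->
  exists2 y, P y & forall z, z < y -> ~~ P z.
Proof.
move=> Px; case: (@arg_minnP _ x P (fun y => #|[set z : L | z <= y]|) Px) => y Py ymin.
exists y => // z yz; apply/negP => /ymin /=; rewrite leqNgt.
by rewrite card_downset_lt.
Qed.

Lemma ex_cover_above x y : x < y -> exists2 z, x <= z & lower_cover z y.
Proof.
move=> xy; have [|z /andP[xz zy] zmax] := @ex_maximal [pred z | (x <= z) && (z < y)] x.
  by rewrite /= lexx.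
exists z => //; rewrite /lower_cover zy; apply/forallP => t; apply/negP.
by case/andP=> /[dup] /ltW /(le_trans xz) xt /zmax /=; rewrite xt /= => /negbTE->.
Qed.

Lemma ex_cover_below x y : x < y -> exists2 z, z <= y & lower_cover x z.
Proof.
move=> xy; have [|z /andP[xz zy] zmin] := @ex_minimal [pred z | (x < z) && (z <= y)] y.
  by rewrite /= lexx andbT.
exists z => //; rewrite /lower_cover xz; apply/forallP => t; apply/negP.
by case/andP=> xt tz; move: (zmin _ tz); rewrite /= xt (le_trans (ltW tz) zy).
Qed.

(** Take [z] minimal below [q] but not below [p]: all elements under [z] lie below [p], so the meet
    of [z] and [p] is its only lower neighbour. *)
Lemma ex_join_irr p q : ~~ (q <= p) ->
  exists r : L, [/\ r \in join_irr L, r <= q & ~~ (r <= p)].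
Proof.
move=> qp; have [|z /andP[zq zp] zmin] := @ex_minimal [pred z | (z <= q) && ~~ (z <= p)] q.
  by rewrite /= lexx.
have {}zmin y : y < z -> y <= p.
  by move=> yz; have := zmin _ yz; rewrite /= (le_trans (ltW yz) zq) negbK.
exists z; split=> //; rewrite inE; apply/cards1P; exists (z `&` p).
have mz : z `&` p < z.
  by rewrite lt_neqAle leIl andbT; apply: contra zp => /eqP <-; apply: leIr.
apply/setP => y; rewrite !inE; apply/andP/eqP => [[yz /forallP ycov]|->].
  have := ycov (z `&` p); rewrite mz andbT lt_neqAle lexI (ltW yz) zmin // !andbT negbK.
  by move/eqP.
split=> //; apply/forallP => t; apply/negP => /andP[mt tz].
by have := lt_geF mt; rewrite lexI (ltW tz) zmin.
Qed.

(** If [r] is below neither, its meets with [x] and [y] lie below its unique lower neighbour [c],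
    and by distributivity so does [r]. *)
Lemma join_irr_prime r x y : r \in join_irr L -> r <= x `|` y -> (r <= x) || (r <= y).
Proof.
rewrite inE => /cards1P[c rc] rxy; apply/negP => /negP; rewrite negb_or => /andP[rx ry].
have below t : ~~ (r <= t) -> r `&` t <= c.
  move=> rt; have : r `&` t < r.
    by rewrite lt_neqAle leIl andbT; apply: contra rt => /eqP <-; apply: leIr.
  case/ex_cover_above => z tz; have := in_set1 z c.
  by rewrite -rc inE => -> /eqP <-.
have : c \in [set q | lower_cover q r] by rewrite rc set11.
rewrite inE => /andP[/lt_geF + _].
by rewrite -(meet_l rxy) meetUr leUx !below.
Qed.

(** If [x] and [y] are join-irreducible below [q] but not [q'], then [q'] joined with [y] is [q], so
    primality gives [x <= y], and symmetrically. *)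
Lemma lower_cover_diff q' q : lower_cover q' q ->
  exists r : 'I_#|join_irr L|, [/\ enum_val r <= q, ~~ (enum_val r <= q') &
    forall r' : 'I_#|join_irr L|, r' != r -> (enum_val r' <= q) = (enum_val r' <= q')].
Proof.
move=> /andP[q'q /forallP cov].
have [r [rP rq rq']] : exists r, [/\ r \in join_irr L, r <= q & ~~ (r <= q')].
  by apply: ex_join_irr; rewrite lt_geF.
have uniq_le x y : x \in join_irr L -> y \in join_irr L -> x <= q -> ~~ (x <= q') ->
    y <= q -> ~~ (y <= q') -> x <= y.
  move=> xP yP xq xq' yq yq'.
  have jq : q' `|` y = q.
    have q'j : q' < q' `|` y.
      by rewrite lt_neqAle leUl andbT; apply: contra yq' => /eqP ->; apply: leUr.
    have := cov (q' `|` y); rewrite q'j lt_neqAle leUx (ltW q'q) yq /= andbT negbK.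
    by move/eqP.
  by have := join_irr_prime xP; rewrite -jq in xq *; move/(_ _ _ xq); rewrite (negbTE xq').
exists (enum_rank_in rP r); rewrite enum_rankK_in //; split=> // r' r'r.
apply/idP/idP => [r'q|/le_trans->//]; last exact: ltW.
apply/negPn/negP => r'q'; move/eqP: r'r; apply; apply: enum_val_inj.
rewrite enum_rankK_in //; apply/le_anti.
by apply/andP; split; apply: uniq_le => //; apply: enum_valP.
Qed.

End Lattice.

(** * The ideals of poset ideals and coideals *)

Section HibiIdeals.
Variables (disp : Order.disp_t) (L : finDistrLatticeType disp) (K : fieldType).
Implicit Types (p q : L) (T : {set L}).
Local Notation P := #|join_irr L|.
Local Notation S := {mpoly K[nvars L]}.
Local Notation u := (@u_mon disp L K).

Definition u_var q (r : 'I_P) : 'I_(nvars L) :=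
  if (enum_val r <= q)%O then lshift P r else rshift P r.

Lemma u_monE q : u q = \prod_r 'X_(u_var q r).
Proof. by apply: eq_bigr => r _; rewrite /u_var; case: ifP. Qed.

Definition u_exp q : 'X_{1..nvars L} := (\sum_r U_(u_var q r))%MM.

Lemma u_monX q : u q = 'X_[u_exp q].
Proof.
by rewrite u_monE /u_exp; elim/big_rec2: _ => [|r m p _ ->]; rewrite ?mpolyX0 ?mpolyXD.
Qed.

Lemma mdeg_u_exp q : mdeg (u_exp q) = P.
Proof.
rewrite mdeg_sum (eq_bigr (fun=> 1%N)) => [|r _]; last by rewrite mdeg1.
by rewrite sum1_card card_ord.
Qed.

Lemma u_var_lshift q r r' : u_var q r = lshift P r' -> (enum_val r' <= q)%O.
Proof.
by rewrite /u_var; case: ifP => [rq /lshift_inj <-|_ /eqP]; rewrite // eq_rlshift.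
Qed.

Lemma u_var_rshift q r r' : u_var q r = rshift P r' -> ~~ (enum_val r' <= q)%O.
Proof.
by rewrite /u_var; case: ifP => [_ /eqP|rq /rshift_inj <-]; rewrite ?rq // eq_lrshift.
Qed.

Lemma u_mon_le p q : u p = u q -> (p <= q)%O.
Proof.
move=> pq; apply/negPn/negP => /ex_join_irr[r [rP rp /negP rq]].
pose i := enum_rank_in rP r.
have : kill [set lshift P i] (u p) == 0.
  rewrite u_monE kill_prodX; apply/existsP; exists i.
  by rewrite inE /u_var enum_rankK_in // rp.
rewrite pq u_monE kill_prodX => /existsP[j]; rewrite inE => /eqP/u_var_lshift.
by rewrite enum_rankK_in.
Qed.

Lemma u_exp_inj : injective u_exp.
Proof. by move=> p q pq; apply/le_anti; rewrite !u_mon_le // !u_monX pq. Qed.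

(** Passing a cover trades a single [y_r] for [x_r], which yields the linear syzygies. *)
Lemma u_mon_cover q' q : lower_cover q' q ->
  exists r : 'I_P, [/\ (enum_val r <= q)%O, ~~ (enum_val r <= q')%O &
    'X_(rshift P r) * u q = 'X_(lshift P r) * u q'].
Proof.
move=> /lower_cover_diff[r [rq rq' eqr]]; exists r; split=> //.
rewrite !u_monE (bigD1 r) //= [in RHS](bigD1 r) //= /u_var rq (negbTE rq') mulrCA.
by congr (_ * (_ * _)); apply: eq_bigr => r' /eqr ->.
Qed.

Lemma H_ideal_gen T q c : q \in T -> H_ideal K T (c * u q).
Proof.
move=> qT; exists (fun p => if p == q then c else 0).
rewrite (bigD1 q) //= eqxx big1 ?addr0 // => p /andP[_ /negbTE->].
by rewrite mul0r.
Qed.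

Lemma H_ideal_sum T (I : finType) (A : pred I) (F : I -> S) :
  (forall i, A i -> H_ideal K T (F i)) -> H_ideal K T (\sum_(i | A i) F i).
Proof.
move=> HF; apply: big_ind => // [|_ _ [c ->] [c' ->]].
  by exists (fun=> 0); rewrite big1 // => q _; rewrite mul0r.
exists (fun q => c q + c' q); rewrite -big_split.
by apply: eq_bigr => q _; rewrite mulrDl.
Qed.

Lemma H_ideal_setU T T' (f : S) : H_ideal K (T :|: T') f <->
  exists g h, [/\ H_ideal K T g, H_ideal K T' h & f = g + h].
Proof.
split=> [[c ->]|[g [h [[c ->] [c' ->] ->]]]]; last first.
  exists (fun q => (if q \in T then c q else 0) + (if q \in T' then c' q else 0)).
  under [RHS]eq_bigr do rewrite mulrDl.
  rewrite big_split /=; congr (_ + _).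
    rewrite [RHS](big_setID T) /= setUK [X in _ + X]big1 ?addr0 => [|q].
      by apply: eq_bigr => q ->.
    by rewrite inE => /andP[/negbTE-> _]; rewrite mul0r.
  rewrite [RHS](big_setID T') /= setIC setKU [X in _ + X]big1 ?addr0 => [|q].
    by apply: eq_bigr => q ->.
  by rewrite inE => /andP[/negbTE-> _]; rewrite mul0r.
exists (\sum_(q in T) c q * u q), (\sum_(q in T' :\: T) c q * u q); split.
- by exists c.
- by apply: H_ideal_sum => q; rewrite inE => /andP[_ qT]; apply: H_ideal_gen.
- by rewrite (big_setID T) /= setUK setDUl setDv set0U.
Qed.

Lemma H_ideal_set1 q (f : S) : H_ideal K [set q] f <-> exists g, f = g * u q.
Proof.
split=> [[c ->]|[g ->]]; last by apply: H_ideal_gen; rewrite set11.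
by rewrite big_set1; exists (c q).
Qed.

Lemma H_ideal_set0 (f : S) : H_ideal K set0 f <-> f = 0.
Proof. by split=> [[c ->]|->]; [|exists (fun=> 0)]; rewrite big_set0. Qed.

(** The colon ideal is generated by the variables in [V]: each [u p] with [p] in [T] contains one of
    them and [u q] none, so [kill V], with values in a domain, sends [f] to 0 whenever [f * u q]
    lies in the ideal. *)
Lemma linres_H_setU1 T q :
  linres P (H_ideal K T) ->
  (forall p, p \in T -> exists i, [/\ i \notin codom (u_var q), i \in codom (u_var p) &
     exists p' j, p' \in T /\ 'X_i * u q = 'X_j * u p']) ->
  linres P (H_ideal K (q |: T)).
Proof.
move=> HT colon.
pose V := [set i | (i \notin codom (u_var q)) &&
  [exists p, [exists j, (p \in T) && ('X_i * u q == 'X_j * u p)]]].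
apply: (@linres_ext _ _ _ (fun f => exists g, H_ideal K T (f - g * u q))).
  move=> f; rewrite H_ideal_setU; split=> [[g Hg]|[g [h [/H_ideal_set1[c ->] Th ->]]]].
    exists (g * u q), (f - g * u q); split=> //; last by rewrite addrC subrK.
    by apply/H_ideal_set1; exists g.
  by exists c; rewrite addrC addKr.
apply: (linres_cone HT (linres_kill K V)).
  by rewrite u_monX dhomogX /= mdeg_u_exp.
move=> f; split=> [f0|[c fE]].
  have [g] := sub_kill V f; rewrite f0 subr0 => ->.
  rewrite mulr_suml; apply: H_ideal_sum => i; rewrite inE.
  case/andP=> _ /existsP[p /existsP[j /andP[pT /eqP XE]]].
  by rewrite -mulrA XE mulrA; apply: H_ideal_gen.
have : kill V (f * u q) = 0.
  rewrite fE rmorph_sum big1 // => p pT; rewrite rmorphM /=.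
  suff /eqP-> : kill V (u p) == 0 by rewrite mulr0.
  have [i [iq /codomP[r irp] [p' [j [p'T XE]]]]] := colon p pT.
  rewrite u_monE kill_prodX; apply/existsP; exists r; rewrite -irp inE iq.
  by apply/existsP; exists p'; apply/existsP; exists j; rewrite p'T XE eqxx.
move/eqP; rewrite rmorphM /= mulf_eq0 => /orP[/eqP //|].
rewrite u_monE kill_prodX => /existsP[r]; rewrite inE => /andP[/negP[]].
exact: codom_f.
Qed.

(** Remove a maximal [q]. For another [p], a lower neighbour [q'] of [q] above the meet of [p] and
    [q] gives [y_r]; it divides [u p], as [r <= p] would force [r <= q']. *)
Lemma linres_H_poset_ideal T : poset_ideal T -> linres P (H_ideal K T).
Proof.
have [m] := ubnP #|T|; elim: m T => // m IH T; rewrite ltnS => Tm Tid.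
have [->|[x xT]] := set_0Vmem T.
  by apply: linres_ext (linres0 _ _ _) => f; rewrite H_ideal_set0.
have [q qT qmax] : exists2 q, q \in T & forall z, (q < z)%O -> z \notin T.
  exact: ex_maximal xT.
rewrite -(setD1K qT); apply: linres_H_setU1.
  apply: IH => [|p p' p'p]; first by rewrite (cardsD1 q) qT in Tm.
  rewrite !inE => /andP[pq pT]; rewrite (Tid _ _ p'p pT) andbT.
  apply: contraNneq pq => p'q; rewrite p'q le_eqVlt eq_sym in p'p.
  by case/orP: p'p => // /qmax; rewrite pT.
move=> p; rewrite !inE => /andP[pq pT].
have qp : ~~ (q <= p)%O.
  by rewrite le_eqVlt eq_sym negb_or pq; apply/negP => /qmax; rewrite pT.
have : (p `&` q < q)%O.
  by rewrite lt_neqAle leIr andbT; apply: contra qp => /eqP <-; apply: leIl.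
case/ex_cover_above => q' pqq' cov.
have [r [rq rq' XE]] := u_mon_cover cov.
exists (rshift P r); split.
- by apply/negP => /codomP[r' /esym/u_var_rshift]; rewrite rq.
- apply/codomP; exists r; rewrite /u_var ifN //; apply: contra rq' => rp.
  by apply: le_trans pqq'; rewrite lexI rp.
- exists q', (lshift P r); split=> //; have /andP[q'q _] := cov.
  by rewrite !inE (Tid q) ?(ltW q'q) // lt_eqF.
Qed.

(** Dually, with an upper neighbour [q'] below the join of [p] and [q]; that [x_r] divides [u p] now
    rests on primality of [r]. *)
Lemma linres_H_poset_coideal T : poset_coideal T -> linres P (H_ideal K T).
Proof.
have [m] := ubnP #|T|; elim: m T => // m IH T; rewrite ltnS => Tm Tco.
have [->|[x xT]] := set_0Vmem T.
  by apply: linres_ext (linres0 _ _ _) => f; rewrite H_ideal_set0.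
have [q qT qmin] : exists2 q, q \in T & forall z, (z < q)%O -> z \notin T.
  exact: ex_minimal xT.
rewrite -(setD1K qT); apply: linres_H_setU1.
  apply: IH => [|p p' pp']; first by rewrite (cardsD1 q) qT in Tm.
  rewrite !inE => /andP[pq pT]; rewrite (Tco _ _ pp' pT) andbT.
  apply: contraNneq pq => p'q; rewrite p'q le_eqVlt in pp'.
  by case/orP: pp' => // /qmin; rewrite pT.
move=> p; rewrite !inE => /andP[pq pT].
have qp : ~~ (p <= q)%O.
  by rewrite le_eqVlt negb_or pq; apply/negP => /qmin; rewrite pT.
have : (q < p `|` q)%O.
  by rewrite lt_neqAle leUr andbT; apply: contra qp => /eqP ->; apply: leUl.
case/ex_cover_below => q' q'pq cov.
have [r [rq' rq XE]] := u_mon_cover cov.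
exists (lshift P r); split.
- by apply/negP => /codomP[r' /esym/u_var_lshift]; rewrite (negbTE rq).
- apply/codomP; exists r; rewrite /u_var ifT //.
  have := join_irr_prime (enum_valP r) (le_trans rq' q'pq).
  by rewrite (negbTE rq) orbF.
- exists q', (rshift P r); split=> //; have /andP[qq' _] := cov.
  by rewrite !inE (Tco q) ?(ltW qq') // gt_eqF.
Qed.

(** Each monomial of [f] is a multiple of some [u q], and equality of degrees leaves no cofactor. *)
Lemma H_ideal_homog_supp T (f : S) (m : 'X_{1..nvars L}) :
  H_ideal K T f -> f \is P.-homog -> m \in msupp f -> exists2 q, q \in T & m = u_exp q.
Proof.
move=> [c fE] fh mf; have mP : mdeg m = P := dhomog_mf fh mf.
have [q qT] : exists2 q, q \in T & m \in msupp (c q * u q).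
  have [/exists_inP//|] := boolP [exists (q | q \in T), m \in msupp (c q * u q)].
  rewrite negb_exists_in => /forall_inP nm; move: mf.
  rewrite mcoeff_msupp fE raddf_sum big1 ?eqxx // => q /nm.
  by rewrite mcoeff_msupp negbK => /eqP.
rewrite u_monX (perm_mem (msuppMX _ _)) => /mapP[m' _ mE]; exists q => //.
move/eqP: mP; rewrite mE mdegD mdeg_u_exp -{2}[P]addn0 eqn_add2l mdeg_eq0 => /eqP->.
by rewrite addm0.
Qed.

End HibiIdeals.

Theorem theorem3p10 (disp : Order.disp_t) (L : finDistrLatticeType disp)
  (K : fieldType) (I J : {set L}) :
  poset_ideal I -> poset_coideal J ->
  I :|: J = [set: L] -> I :&: J = set0 ->
  has_linear_resolution (fun f : {mpoly K[nvars L]} =>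
                           H_ideal K I f /\ H_ideal K J f).
Proof.
move=> Iid Jco IJT IJ0; apply: (@linres_has_linear_resolution _ _ #|join_irr L|.+1).
apply: linres_cap.
- exact: linres_H_poset_ideal.
- exact: linres_H_poset_coideal.
- apply: (@linres_ext _ _ _ (H_ideal K (I :|: J))) => [f|].
    exact: H_ideal_setU.
  (* The whole lattice is itself a poset ideal. *)
  by rewrite IJT; apply: linres_H_poset_ideal => p q; rewrite !inE.
(* A monomial of [f] would be [u q = u p] with [q] in [I] and [p] in [J], contradicting
   disjointness. *)
move=> f fI fJ fh; apply/eqP; rewrite -msupp_eq0.
case supp_f: (msupp f) => [|m s] //.
have mf : m \in msupp f by rewrite supp_f mem_head.
have [q qI mq] := H_ideal_homog_supp fI fh mf.
have [p pJ mp] := H_ideal_homog_supp fJ fh mf.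
have pq : p = q by apply: (u_exp_inj K); rewrite -mp.
by move/setP: IJ0 => /(_ q); rewrite !inE qI -pq pJ.
Qed.
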